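(* Let $d\ge 2$, $k\ge 2$, and let $C$ be a normal $k$-banner $(d-1)$-complex on $n$ vertices. If $\Gamma=[F_0,\dots,F_\ell]$ is a monotone conservative path in $C$ towards a set $S$ of vertices, then the length of $\Gamma$ satisfies $\ell\le n2^{k-2}$.
   Context: All simplicial complexes are finite. A complex is pure of dimension $d-1$ (a $(d-1)$-complex) if all its facets (inclusion-maximal faces) have $d$ elements. Two facets are adjacent if they differ in a single vertex; this defines the dual graph. A dual path is a path $[F_0,\dots,F_N]$ in the dual graph, and its length is $N$. A pure complex is normal if between every two facets $F,F'$ there is a dual path consisting only of facets containing $F\cap F'$. The link of a vertex $v$ is $\mathrm{lk}_C(v)=\{f\in C: v\notin f,\ f\cup\{v\}\in C\}$. Banner complexes. A critical clique of $C$ is a set $T$ of vertices forming a clique in the 1-skeleton of $C$ such that $T\setminus\{v\}$ is a face of $C$ for some $v\in T$. $C$ is $k$-banner if every critical clique of size at least $k+1$ is a face of $C$. Vertex-distance. $\mathrm{vdist}_C(u,v)$ is the graph distance in the 1-skeleton of $C$, and $\mathrm{vdist}_C(S,S')=\min_{u\in S,v\in S'}\mathrm{vdist}_C(u,v)$, equal to $\infty$ if $S$ or $S'$ is empty. If $\dim C=0$, then for nonempty $S,S'$ one sets $\mathrm{vdist}_C(S,S')=0$ if $S\cap S'\neq\emptyset$ and $1$ otherwise. Vector of distances. Let $F=(v_1,\dots,v_d)$ be an ordered facet (a facet with an ordering of its vertices) of a pure $(d-1)$-complex $C$ and $S$ a set of vertices of $C$ (target set). The vector of distances $(\lambda_1,\dots,\lambda_d)$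 from $F$ to $S$ is defined recursively: $\lambda_1=\mathrm{vdist}_C(v_1,S)$, and $(\lambda_2,\dots,\lambda_d)$ is the vector of distances from $F\setminus v_1$ (with induced order) to $S'$ in $\mathrm{lk}_C(v_1)$, where, with $V_1$ the vertex set of $\mathrm{lk}_C(v_1)$, $S'=\{v\in V_1:\mathrm{vdist}_C(v,S)=\mathrm{vdist}_C(v_1,S)-1\}$ if $v_1\notin S$, and $S'=S\cap V_1$ if $v_1\in S$. (If the target set is empty at some stage, all entries from there on are $\infty$.) The ordering is admissible with respect to $S$ if $\lambda_1=\mathrm{vdist}_C(F,S)$ and $F\setminus v_1$ is admissible with respect to $S'$ in $\mathrm{lk}_C(v_1)$ (the empty ordered facet is admissible). Monotone conservative paths. Let $C$ be pure and normal, $S$ a nonempty target set, and $[F_0,\dots,F_N]$ a dual path of ordered facets. It is monotone towards $S$ if the vectors of distances of $F_0,\dots,F_N$ to $S$ are strictly lexicographically decreasing. The index of a step from $F_{i-1}=(v_1,\dots,v_d)$ to $F_i=(v_1',\dots,v_d')$ is the minimum $k$ with $v_k\neq v_k'$. The step is conservative towards $S$ if (i) the vertex in $F_{i-1}\setminus F_i$ is the last vertex in the ordering of $F_{i-1}$, and (ii) the ordering of $F_i$ is admissible with respect to $S$ and has the maximum index among all admissible reorderings of $F_i$. The path is conservative towards $S$ if $F_0$ is admissible with respect to $S$ and every step is conservative. A monotone conservative path towards $S$ is a dual path of ordered facets that is monotone and conservative towards $S$. *)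

(* Defs.v *)
From HB Require Import structures.
From mathcomp Require Import all_boot all_order.

Set Implicit Arguments.
Unset Strict Implicit.
Unset Printing Implicit Defensive.

Import Order.TTheory.

(* Distances live in nat extended with a greatest element: None is infinity. *)
Definition enat : Type := option nat.

HB.instance Definition _ := Countable.on enat.

Definition le_enat (x y : enat) : bool :=
  match x, y with
  | _, None => true
  | None, Some _ => false
  | Some m, Some n => m <= n
  end.

Fact le_enat_refl : reflexive le_enat.
Proof. by case=> [m|] /=. Qed.

Fact le_enat_anti : antisymmetric le_enat.
Proof. by move=> [m|] [n|] //= mn; congr Some; apply/eqP; rewrite eqn_leq. Qed.

Fact le_enat_trans : transitive le_enat.
Proof. by move=> [n|] [m|] [p|] //=; apply: leq_trans. Qed.

Fact le_enat_total : total le_enat.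
Proof. by move=> [m|] [n|] //=; apply: leq_total. Qed.

Fact enat_display : Order.disp_t. Proof. exact: Order.Disp tt tt. Qed.

HB.instance Definition _ := Order.Le_isPOrder.Build enat_display enat
  le_enat_refl le_enat_anti le_enat_trans.
HB.instance Definition _ :=
  Order.POrder_isTotal.Build enat_display enat le_enat_total.

Fact le_enat_top (x : enat) : (x <= (None : enat))%O.
Proof. by case: x. Qed.

HB.instance Definition _ :=
  Order.hasTop.Build enat_display enat le_enat_top.

Section Complexes.

Variable V : finType.
Implicit Types (C : {set {set V}}) (F G T S : {set V}) (u v : V).
Implicit Types (k d : nat) (s t : seq V).

(* The ambient type V may contain elements that are not vertices of C. *)
Definition is_complex C : Prop :=
  set0 \in C /\ forall F G, F \in C -> G \subset F -> G \in C.

Definition verts C : {set V} := [set v | [set v] \in C].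

Definition facets C : {set {set V}} := [set F | maxset (fun G => G \in C) F].

(* Pure of dimension d - 1. *)
Definition pure C d : Prop := forall F, F \in facets C -> #|F| = d.

Definition link C v : {set {set V}} :=
  [set F in C | (v \notin F) && (v |: F \in C)].

Definition dual_adj F G : bool := (#|F :\: G| == 1) && (#|G :\: F| == 1).

Definition dual_path C F (Gs : seq {set V}) : bool :=
  all (fun G => G \in facets C) (F :: Gs) && path dual_adj F Gs.

Definition normal_complex C : Prop :=
  forall F G, F \in facets C -> G \in facets C ->
  exists Hs : seq {set V},
    [/\ dual_path C F Hs, last F Hs = G
      & all (fun H : {set V} => F :&: G \subset H) (F :: Hs)].

Definition edge C : rel V := [rel u v | (u != v) && ([set u; v] \in C)].

Definition critical_clique C T : Prop :=
  [/\ T \subset verts C,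
      {in T &, forall u v, u != v -> edge C u v}
    & exists2 v, v \in T & T :\ v \in C].

Definition banner k C : Prop :=
  forall T, critical_clique C T -> k.+1 <= #|T| -> T \in C.

Definition walk C u v (m : nat) : bool :=
  [exists p : m.-tuple V, path (edge C) u p && (last u p == v)].

Lemma walk_connect C u v : connect (edge C) u v -> exists m, walk C u v m.
Proof.
case/connectP=> p pth ->; exists (size p).
by apply/existsP; exists (in_tuple p); rewrite pth eqxx.
Qed.

(* Graph distance in the 1-skeleton of C. *)
Definition vdist C u v : enat :=
  if @idP (connect (edge C) u v) is ReflectT uv
  then Some (ex_minn (walk_connect uv)) else None.

(* 1 + the dimension of C. *)
Definition rank C : nat := \max_(F in C) #|F|.

Definition vdistS C S T : enat :=
  if rank C == 1 then
    if (S == set0) || (T == set0) then None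
    else if S :&: T != set0 then Some 0 else Some 1
  else \big[Order.min / \top%O]_(u in S) \big[Order.min / \top%O]_(v in T)
         vdist C u v.

(* The target set S' in the link of v.  When the distance from v to S is
   infinite, in particular when S is empty, S' is empty, so that an empty
   target set stays empty. *)
Definition next_target C v S : {set V} :=
  if v \in S then S :&: verts (link C v)
  else if vdistS C [set v] S is Some m
  then [set u in verts (link C v) | vdistS C [set u] S == Some m.-1]
  else set0.

Definition vset s : {set V} := [set v in s].

Definition ordered_facet C s : bool := uniq s && (vset s \in facets C).

Fixpoint dist_vector C s S : seq enat :=
  if s is v :: s' then
    vdistS C [set v] S :: dist_vector (link C v) s' (next_target C v S)
  else [::].

Fixpoint admissible C s S : bool :=
  if s is v :: s' then
    (vdistS C [set v] S == vdistS C (vset s) S) &&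
    admissible (link C v) s' (next_target C v S)
  else true.

Definition step_index s t : nat := (find (fun p => p.1 != p.2) (zip s t)).+1.

Definition conservative_step C S s t : Prop :=
  [/\ (exists s' v, s = rcons s' v /\ vset s :\: vset t = [set v]),
      admissible C t S
    & forall t', perm_eq t' t -> admissible C t' S ->
        step_index s t' <= step_index s t].

(* Paths of ordered facets are given by their first ordered facet s and the
   sequence ss of the following ones, so that their length is size ss. *)
Definition ordered_dual_path C s (ss : seq (seq V)) : Prop :=
  all (ordered_facet C) (s :: ss) /\ dual_path C (vset s) (map vset ss).

Definition monotone C S s (ss : seq (seq V)) : Prop :=
  path (fun x y : seqlexi enat => (y < x)%O)
    (dist_vector C s S) [seq dist_vector C t S | t <- ss].

Definition conservative C S s (ss : seq (seq V)) : Prop :=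
  admissible C s S /\
  forall i, i < size ss ->
    conservative_step C S (nth [::] (s :: ss) i) (nth [::] ss i).

Definition monotone_conservative_path C S s (ss : seq (seq V)) : Prop :=
  [/\ ordered_dual_path C s ss, monotone C S s ss & conservative C S s ss].

End Complexes.

(* Main.v *)
(* Group the facets of the path into runs with the same first vertex a.  A run
   lives in the star of a and is a monotone conservative path in the link of a,
   which is (k-1)-banner.  Conservativeness keeps a until a vertex strictly
   closer to S is reached, so the distance D to S drops by exactly one between
   runs, and a vertex x can only lie in the runs whose first vertex has
   distance D x or D x - 1.  By induction on k, the runs have total length at
   most 2^(k-3) times twice the number of vertices.  For k = 2 a stronger bound
   holds: the path is non-revisiting.  Indeed, if x lies in two consecutive
   runs with first vertices a and b, then flagness puts {a, x, b} in C, so that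
   x is at distance one from the target in the link of a, and by induction on
   the dimension x stays until the end of the run of a. *)
Require Import Defs.
From mathcomp Require Import all_boot all_order.
From mathcomp Require Import zify.

Set Implicit Arguments.
Unset Strict Implicit.
Unset Printing Implicit Defensive.

Import Order.TTheory.

Lemma leEenat (x y : enat) : (x <= y)%O = le_enat x y.
Proof. by []. Qed.

(** A finite bound excludes the default value [None] of an empty minimum, so some index must witness
    it. *)
Lemma bigmin_le_ex (I : finType) (P : pred I) (f : I -> enat) m :
  (\big[Order.min / \top%O]_(i | P i) f i <= (Some m : enat))%O ->
  exists2 i, P i & (f i <= (Some m : enat))%O.
Proof.
move=> le_m; case: (pickP [pred i | P i && (f i <= (Some m : enat))%O]).
  by move=> i /andP[]; exists i.
move=> none; move: le_m; rewrite leNgt => /negP[]; apply/bigmin_gtP.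
split=> // i Pi; rewrite ltNge; apply/negP=> le_i.
by have := none i; rewrite /= Pi le_i.
Qed.

(** * Distances to a target set in the 1-skeleton *)

Section Distance.

Variables (V : finType) (C : {set {set V}}).
Implicit Types (F S : {set V}) (u v x : V).

Lemma rank_pure d : set0 \in C -> pure C d -> rank C = d.
Proof.
move=> C0 pC; apply/eqP; rewrite eqn_leq; apply/andP; split.
  apply/bigmax_leqP => F CF.
  have [G maxG sFG] := @maxset_exists _ (fun G => G \in C) F CF.
  by rewrite -(pC G) ?inE //; apply: subset_leq_card.
have [G maxG _] := @maxset_exists _ (fun G => G \in C) set0 C0.
rewrite -(pC G) ?inE // /rank.
apply: (@leq_bigmax_cond _ (mem C) (fun G : {set V} => #|G|) G).
by have /maxsetP[] := maxG.
Qed.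

Lemma vdist_leP u v m :
  (vdist C u v <= (Some m : enat))%O <->
  exists p, [/\ path (edge C) u p, last u p = v & size p <= m].
Proof.
rewrite /vdist; case: {-}_ / idP => [uv | nuv].
  rewrite leEenat /=; case: ex_minnP => n /existsP[p /andP[pth /eqP lp]] minn.
  split=> [le_nm | [q [qth lq le_qm]]].
    by exists p; split=> //; rewrite size_tuple.
  by apply: leq_trans (minn (size q) _) le_qm; apply/existsP;
    exists (in_tuple q); rewrite qth lq eqxx.
split=> // -[p [pth lp _]]; case: nuv; apply/connectP; exists p => //.
Qed.

Lemma vdistS1_leP S x m : rank C != 1 ->
  (vdistS C [set x] S <= (Some m : enat))%O <->
  exists2 v, v \in S &
    exists p, [/\ path (edge C) x p, last x p = v & size p <= m].
Proof.
move=> rC; rewrite /vdistS (negPf rC); split.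
  case/bigmin_le_ex=> u /set1P-> /bigmin_le_ex[v Sv /vdist_leP].
  by exists v.
case=> v Sv /vdist_leP le_m.
apply: (@bigmin_inf _ _ _ _ x); first exact/set11.
exact: bigmin_inf Sv le_m.
Qed.

Lemma vdistS_le_mem F S v :
  v \in F -> (vdistS C F S <= vdistS C [set v] S)%O.
Proof.
move=> Fv; rewrite /vdistS; case: ifP => _; last first.
  by rewrite big_set1E (min_idPl (lex1 _)); apply: bigmin_le_cond Fv.
have -> : (F == set0) = false by apply/eqP=> F0; rewrite F0 inE in Fv.
have -> : ([set v] == set0) = false by rewrite -cards_eq0 cards1.
case: (S == set0) => //=.
case: (altP (F :&: S =P set0)) => //= FS; last by case: ifP.
case: eqP => // -[]; apply/setP=> x; rewrite !inE.
apply/negbTE/negP=> /andP[/eqP-> Sv].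
by have /setP/(_ v) := FS; rewrite !inE Fv Sv.
Qed.

Lemma vdistS_attained F S : F \in C -> F != set0 ->
  exists2 v, v \in F & vdistS C [set v] S = vdistS C F S.
Proof.
move=> CF /set0Pn[v Fv]; case: (altP (rank C =P 1)) => rC; last first.
  rewrite /vdistS (negPf rC).
  have [|u Fu ->] := @eq_bigmin _ enat _ (\top%O) v [pred u in F]
    (fun u => \big[Order.min / \top%O]_(w in S) vdist C u w) Fv.
    by move=> *; apply: lex1.
  by exists u; rewrite // big_set1E (min_idPl (lex1 _)).
(* In rank 1 a nonempty face has just one vertex. *)
exists v => //; suff -> : F = [set v] by [].
apply/esym/eqP; rewrite eqEcard sub1set Fv cards1 -rC.
by apply: (@leq_bigmax_cond _ (mem C) (fun G : {set V} => #|G|) F CF).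
Qed.

End Distance.

(** * Edges, links and the banner condition *)

Section Link.

Variables (V : finType).
Implicit Types (C : {set {set V}}) (F G S : {set V}) (u v x a : V).
Implicit Types (s t : seq V) (d k : nat).

Lemma vdistS_eq0 C S x : rank C != 1 ->
  (vdistS C [set x] S == Some 0) = (x \in S).
Proof.
move=> rC; apply/eqP/idP => [D0 | Sx].
  have /(vdistS1_leP _ _ _ rC) : (vdistS C [set x] S <= (Some 0 : enat))%O.
    by rewrite D0.
  by case=> v Sv [[|y p] [] //= _ ->].
have : (vdistS C [set x] S <= (Some 0 : enat))%O.
  by apply/(vdistS1_leP _ _ _ rC); exists x => //; exists [::].
by case: (vdistS _ _ _) => [[|n]|].
Qed.

Lemma vdistS_edge C S u v m : rank C != 1 -> edge C u v ->
  (vdistS C [set v] S <= (Some m : enat))%O ->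
  (vdistS C [set u] S <= (Some m.+1 : enat))%O.
Proof.
move=> rC uv /(vdistS1_leP _ _ _ rC)[w Sw [p [pth lp le_pm]]].
by apply/(vdistS1_leP _ _ _ rC); exists w => //; exists (v :: p); rewrite /= uv.
Qed.

Lemma face_edge C F u v : is_complex C -> F \in C -> u \in F -> v \in F ->
  u != v -> edge C u v.
Proof.
move=> [_ sC] CF Fu Fv uv; rewrite /edge /= uv (sC F) //.
by apply/subsetP=> x; rewrite !inE => /orP[] /eqP->.
Qed.

Lemma mem_link C a F : is_complex C ->
  (F \in link C a) = (a \notin F) && (a |: F \in C).
Proof.
case=> _ sC; rewrite inE; case aF: (a \notin F) => /=; last by rewrite andbF.
by apply: andb_idl => CaF; apply: sC CaF (subsetU1 _ _).
Qed.

Lemma link_setD1 C a F : is_complex C -> F \in C -> a \in F ->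
  F :\ a \in link C a.
Proof. by move=> cC CF aF; rewrite mem_link // setD11 setD1K. Qed.

Lemma link_complex C a : is_complex C -> [set a] \in C -> is_complex (link C a).
Proof.
move=> cC Ca; split=> [|F G]; rewrite ?mem_link //; first by rewrite inE setU0.
case/andP=> aF CaF sGF; apply/andP; split.
  exact: contra (subsetP sGF _) aF.
by case: cC => _ sC; apply: sC CaF (setUS _ sGF).
Qed.

Lemma facets_mem C F : F \in facets C -> F \in C.
Proof. by rewrite inE => /maxsetP[]. Qed.

Lemma face_sub_facet C F : F \in C -> exists2 G, G \in facets C & F \subset G.
Proof.
move=> CF; have [G maxG sFG] := @maxset_exists _ (fun G => G \in C) F CF.
by exists G; rewrite ?inE.
Qed.

Lemma link_facet C a F : is_complex C -> F \in facets C -> a \in F ->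
  F :\ a \in facets (link C a).
Proof.
move=> cC fF aF; have CF := facets_mem fF.
rewrite inE; apply/maxsetP; split; first exact: link_setD1.
move=> G; rewrite mem_link // => /andP[aG CaG] sFG.
move: fF; rewrite inE => /maxsetP[_ /(_ _ CaG) maxF].
by rewrite -maxF ?setU1K // -(setD1K aF) setUS.
Qed.

Lemma link_pure C a d : is_complex C -> pure C d -> pure (link C a) d.-1.
Proof.
move=> cC pC F fF; have := facets_mem fF; rewrite mem_link // => /andP[aF CaF].
have [G fG sG] := face_sub_facet CaF.
have aG : a \in G by apply: (subsetP sG); apply: setU11.
have lG : G :\ a \in link C a by apply: link_setD1 (facets_mem fG) aG.
move: fF; rewrite inE => /maxsetP[_ /(_ _ lG) maxF].
rewrite -maxF; last by rewrite subsetD1 aF (subset_trans (subsetU1 a F)).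
by rewrite -(pC G fG) (cardsD1 a G) aG.
Qed.

Lemma banner_leq k l C : k <= l -> banner k C -> banner l C.
Proof. by move=> kl bC T cT lT; apply: bC => //; apply: leq_ltn_trans lT. Qed.

Lemma verts_link C a v : is_complex C ->
  (v \in verts (link C a)) = (edge C a v).
Proof.
by move=> cC; rewrite inE mem_link // inE.
Qed.

(** Adding [a] to a critical clique of the link gives a critical clique of [C] with one more vertex,
    and the same vertex [w] witnesses criticality. *)
Lemma link_banner C a k : is_complex C -> [set a] \in C ->
  banner k.+1 C -> banner k (link C a).
Proof.
move=> cC Ca bC T [/subsetP sT clT [w Tw lTw]] cardT.
have sC := cC.2.
have aT : a \notin T.
  by apply/negP=> /sT; rewrite verts_link // /edge /= eqxx.
have aw : a != w by apply: contraNneq aT => ->.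
rewrite mem_link // aT /=; apply: bC; last by rewrite cardsU1 aT.
have edgeT v : v \in T -> edge C a v by move/sT; rewrite verts_link.
split.
- apply/subsetP=> v /setU1P[->|/edgeT/andP[_ Cav]]; rewrite inE //.
  by apply: sC Cav _; rewrite sub1set setU1r // set11.
- move=> u v /setU1P[->|Tu] /setU1P[->|Tv]; rewrite ?eqxx //.
  + by move=> _; apply: edgeT.
  + by move=> _; have := edgeT u Tu; rewrite /edge /= eq_sym setUC.
  move=> uv; have := clT u v Tu Tv uv; rewrite /edge /= uv /=.
  by rewrite mem_link // => /andP[_]; move/sC; apply; apply: subsetU1.
exists w; first by rewrite setU1r.
move: lTw; rewrite mem_link // => /andP[_].
suff -> : a |: T :\ w = (a |: T) :\ w by [].
apply/setP=> x; rewrite !inE; case: (x =P a) => //= ->.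
by rewrite aw.
Qed.

(** The three vertices form a critical clique, as removing [z] leaves the edge between [x] and [y];
    three is the least size covered by [banner 2]. *)
Lemma flag_triangle C x y z : is_complex C -> banner 2 C ->
  edge C x y -> edge C x z -> edge C y z -> [set x; y; z] \in C.
Proof.
move=> cC bC exy exz eyz; have sC := cC.2.
have [/andP[xy Cxy] /andP[xz Cxz] /andP[yz Cyz]] := And3 exy exz eyz.
have sub v : v \in [set x; y; z] -> exists2 F, F \in C & v \in F.
  rewrite !inE -orbA => /or3P[] /eqP->.
  - by exists [set x; y]; rewrite // !inE eqxx.
  - by exists [set x; y]; rewrite // !inE eqxx orbT.
  - by exists [set x; z]; rewrite // !inE eqxx orbT.
have sym u v : edge C u v -> edge C v u by rewrite /edge /= eq_sym setUC.
apply: bC; last by rewrite -setUA !cardsU1 !inE negb_or xy xz yz cards1.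
split.
- by apply/subsetP=> v /sub[F CF Fv]; rewrite inE (sC F) // sub1set.
- move=> u v; rewrite !inE -!orbA.
  by case/or3P=> /eqP-> /or3P[] /eqP-> //; rewrite ?eqxx // => _; auto.
exists z; first by rewrite !inE eqxx orbT.
apply: sC Cxy _; apply/subsetP=> v; rewrite !inE => /andP[/negPf->].
by rewrite orbF.
Qed.

End Link.

(** * Recursive form of the paths, and admissible orderings *)

Section MonotoneConservative.

Variables (V : finType).
Implicit Types (C : {set {set V}}) (F G S : {set V}) (u v x a b : V).
Implicit Types (s t : seq V) (ss ps r : seq (seq V)) (d k m : nat).

Definition mc_step C S s t : Prop :=
  conservative_step C S s t /\
  ((dist_vector C t S : seqlexi enat) < (dist_vector C s S : seqlexi enat))%O.

(** Recursion on the path makes suffixes and prefixes paths again; every facet carries its own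
    admissibility. *)
Fixpoint mc_path C S s ss : Prop :=
  [/\ ordered_facet C s, admissible C s S
    & if ss is t :: ss' then mc_step C S s t /\ mc_path C S t ss' else True].

Fixpoint support s ss : {set V} :=
  vset s :|: if ss is t :: ss' then support t ss' else set0.

Lemma mc_pathP C S s ss :
  monotone_conservative_path C S s ss -> mc_path C S s ss.
Proof.
case=> -[ofs _]; rewrite /monotone.
elim: ss s ofs => [|t ss IH] s /= /andP[os oss] mono [adms cons]; first by [].
split=> //; case/andP: mono => lt_ts mono.
have stepst := cons 0 isT.
split; first by split.
by apply: IH => //; split=> [|i lti]; [case: stepst | apply: (cons i.+1)].
Qed.

Lemma mc_path_head C S s ss :
  mc_path C S s ss -> ordered_facet C s /\ admissible C s S.
Proof. by case: ss => [|? ?] []. Qed.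

Lemma vset_cons a s : vset (a :: s) = a |: vset s.
Proof. by apply/setP=> x; rewrite !inE. Qed.

Lemma ordered_facet_size C d s : pure C d -> ordered_facet C s -> size s = d.
Proof.
by move=> pC /andP[us fs]; rewrite -(pC _ fs) cardsE; apply/esym/card_uniqP.
Qed.

Lemma ordered_facet_mem C s : ordered_facet C s -> vset s \in C.
Proof. by case/andP=> _ /facets_mem. Qed.

Lemma ordered_facet_link C a s : is_complex C -> ordered_facet C (a :: s) ->
  ordered_facet (link C a) s.
Proof.
move=> cC /andP[/= /andP[as_ us] fs]; rewrite /ordered_facet us /=.
have -> : vset s = vset (a :: s) :\ a by rewrite vset_cons setU1K // inE.
by apply: link_facet; rewrite // inE mem_head.
Qed.

(** Greedy choice: a nearest vertex comes first, and the rest is ordered in its link. *)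
Lemma admissible_exists C S F : is_complex C -> F \in C ->
  exists s, [/\ uniq s, vset s = F & admissible C s S].
Proof.
have [n] := ubnP #|F|; elim: n C S F => // n IH C S F ltF cC CF.
have [-> | F0] := eqVneq F set0.
  by exists [::]; split=> //; apply/setP=> x; rewrite !inE.
have [a Fa Da] := vdistS_attained S CF F0.
have Ca : [set a] \in C by apply: (cC.2 F) => //; rewrite sub1set.
have [|s [us eF adms]] := IH (link C a) (next_target C a S) (F :\ a) _
    (link_complex cC Ca) (link_setD1 cC CF Fa).
  by rewrite (cardsD1 a F) Fa in ltF.
have as_ : a \notin s by have /setP/(_ a) := eF; rewrite !inE eqxx /= => ->.
exists (a :: s); rewrite /= as_ us vset_cons eF setD1K //.
by rewrite Da eqxx adms.
Qed.

(** Supplies the competing reordering that the maximality of the index is tested against. *)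
Lemma admissible_exists_head C S F a : is_complex C -> F \in C -> a \in F ->
  vdistS C [set a] S = vdistS C F S ->
  exists s, [/\ uniq (a :: s), vset (a :: s) = F & admissible C (a :: s) S].
Proof.
move=> cC CF Fa Da.
have Ca : [set a] \in C by apply: (cC.2 F) => //; rewrite sub1set.
have [s [us eF adms]] := admissible_exists (next_target C a S)
    (link_complex cC Ca) (link_setD1 cC CF Fa).
have as_ : a \notin s by have /setP/(_ a) := eF; rewrite !inE eqxx /= => ->.
exists s; rewrite /= as_ us vset_cons eF setD1K //.
by rewrite Da eqxx adms.
Qed.

(** * One step of a path, and the first run *)

Lemma step_index_cons a s b t :
  step_index (a :: s) (b :: t) = if a == b then (step_index s t).+1 else 1.
Proof. by rewrite /step_index /=; case: eqP. Qed.

(** Condition (i) of a conservative step, with the new facet kept only as a vertex set [G], so that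
    it passes to a link by deleting a vertex from [G]. *)
Definition drops_last s G : Prop :=
  exists s' v, s = rcons s' v /\ vset s :\: G = [set v].

Lemma drops_last_cons a s G : s != [::] -> uniq (a :: s) ->
  drops_last (a :: s) G -> a \in G /\ drops_last s (G :\ a).
Proof.
move=> s0 /= /andP[as_ _] [s' [v [es ev]]].
case: s' es s0 => [[_ ->]|c s' [_ es]] // _.
have av : a != v by apply: contraNneq as_ => ->; rewrite es mem_rcons mem_head.
have aG : a \in G.
  by have /setP/(_ a) := ev; rewrite !inE eqxx /= andbT (negPf av) => /negbFE.
split=> //; exists s', v; split=> //; rewrite -ev; apply/setP=> x; rewrite !inE.
by case: (x =P a) => //= ->; rewrite (negPf as_) aG.
Qed.

(** As [s] is nonempty, the dropped vertex is not [a], so [a] lies in the new facet. If [b] differs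
    from [a] but is equally far from [S], an admissible reordering headed by [a] has index above 1,
    against maximality. So [b] is strictly nearer, and being adjacent to [a] it is nearer by exactly
    one. *)
Lemma mc_step_head C S d a s b t : is_complex C -> pure C d -> 1 < d ->
  ordered_facet C (a :: s) -> admissible C (a :: s) S ->
  ordered_facet C (b :: t) -> mc_step C S (a :: s) (b :: t) ->
  b = a \/
  exists2 m, vdistS C [set a] S = Some m.+1 & vdistS C [set b] S = Some m.
Proof.
move=> cC pC d1 oas adms obt [cstep _].
have rC : rank C != 1 by rewrite (rank_pure cC.1 pC) neq_ltn d1 orbT.
have [ucs _] := andP oas; have [ubt _] := andP obt.
have s0 : s != [::].
  have := ordered_facet_size pC oas.
  by case: s {adms oas cstep ucs} => //= ?; lia.
have [dl admt maxi] := cstep; have [tab _] := drops_last_cons s0 ucs dl.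
have Cbt := ordered_facet_mem obt.
have [-> | ba] := eqVneq b a; first by left.
right.
have Db : vdistS C [set b] S = vdistS C (vset (b :: t)) S.
  by have /andP[/eqP] := admt.
have le_ba : (vdistS C [set b] S <= vdistS C [set a] S)%O.
  by rewrite Db; apply: vdistS_le_mem.
have ne_ba : vdistS C [set a] S <> vdistS C [set b] S.
  move=> Dab; have [t' [ut' et' admt']] :=
    admissible_exists_head cC Cbt tab (etrans Dab Db).
  have pt' : perm_eq (a :: t') (b :: t).
    apply: uniq_perm => // x.
    by have /setP/(_ x) := et'; rewrite !inE.
  have := maxi _ pt' admt'.
  by rewrite !step_index_cons eqxx [a == b]eq_sym (negPf ba).
have eab : edge C a b.
  by apply: (face_edge cC Cbt) => //; rewrite 1?eq_sym // inE mem_head.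
have := @vdistS_edge _ C S a b _ rC eab.
move: le_ba ne_ba; case: (vdistS C [set b] S) => [m|]; last first.
  by case: (vdistS C [set a] S).
case: (vdistS C [set a] S) => [n|] le_ba ne_ba /(_ m (lexx _)) //.
rewrite leEenat /= => le_nm; rewrite leEenat /= in le_ba; exists m => //.
congr Some; apply/eqP; rewrite eqn_leq le_nm ltn_neqAle le_ba andbT.
by apply/eqP=> emn; rewrite emn in ne_ba.
Qed.

(** Prefixing [a] turns an admissible reordering in the link into one in [C] and raises the index by
    one, so maximality descends. The distance vectors share their first entry, so the strict
    decrease lies in the tails. *)
Lemma mc_step_link C S a s t : s != [::] -> uniq (a :: s) -> uniq (a :: t) ->
  mc_step C S (a :: s) (a :: t) ->
  mc_step (link C a) (next_target C a S) s t.
Proof.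
move=> s0 uas /andP[at_ _] [[dl adm maxi] lt_ts].
split; last first.
  by move: lt_ts; rewrite /= ltxi_cons lexx.
case/andP: adm => Da adm; split=> //.
  have [_] := drops_last_cons s0 uas dl.
  by rewrite vset_cons setU1K // inE.
move=> t' ptt' adm'; have := maxi (a :: t').
rewrite !step_index_cons eqxx perm_cons => /(_ ptt'); apply.
rewrite /= adm' andbT (eqP Da); apply/eqP; congr (vdistS _ _ _).
rewrite !vset_cons; congr (_ |: _).
by apply/setP=> x; rewrite !inE (perm_mem ptt').
Qed.

(** Cuts off the first run: steps keeping the head descend to the link, and the first step changing
    it starts the next run at [b]. *)
Lemma mc_path_split C S d a s ss : is_complex C -> pure C d -> 1 < d ->
  mc_path C S (a :: s) ss ->
  exists2 ps, mc_path (link C a) (next_target C a S) s ps &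
  ss = map (cons a) ps \/
  exists b t r m, [/\ ss = map (cons a) ps ++ (b :: t) :: r,
    drops_last (a :: last s ps) (vset (b :: t)), mc_path C S (b :: t) r,
    vdistS C [set a] S = Some m.+1 & vdistS C [set b] S = Some m].
Proof.
move=> cC pC d1; elim: ss s => [|t ss IH] s /= [oas /andP[Da adms] path_ss].
  by exists [::] => //=; [split; rewrite // (ordered_facet_link cC) | left].
have ols := ordered_facet_link cC oas; have [uas _] := andP oas.
have s0 : s != [::].
  have := ordered_facet_size pC oas.
  by case: s {adms oas ols path_ss Da uas} => //= ?; lia.
case: t path_ss => [|b t] [st path_ss].
  have [/(ordered_facet_size pC) /= ot _] := mc_path_head path_ss.
  by rewrite -ot in d1.
move: st path_ss; have [-> | ba] := eqVneq b a => st path_ss.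
  have [ps path_ps es] := IH _ path_ss; exists (t :: ps).
    split=> //; split=> //.
    by apply: mc_step_link st => //; have [/andP[]] := mc_path_head path_ss.
  case: es => [-> | [b' [t' [r [m [-> st' path_r Da' Db']]]]]]; first by left.
  by right; exists b', t', r, m.
exists [::]; first by split.
have adm_as : admissible C (a :: s) S by rewrite /= Da.
have [obt _] := mc_path_head path_ss.
case: (mc_step_head cC pC d1 oas adm_as obt st) => [eba | [m Dam Dbm]].
  by rewrite eba eqxx in ba.
by right; exists b, t, ss, m; split=> //; case: st => -[].
Qed.

(** * Subpaths and supports *)

Lemma mc_path_catl C S s ps r : mc_path C S s (ps ++ r) -> mc_path C S s ps.
Proof.
by elim: ps s => [|t ps IH] s /=; [case/mc_path_head | case=> ? ? [? /IH]].
Qed.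

Lemma mc_path_last C S s ss : mc_path C S s ss -> ordered_facet C (last s ss).
Proof. by elim: ss s => [|t ss IH] s /= [] // _ _ [_ /IH]. Qed.

Lemma support_cat s ps t r :
  support s (ps ++ t :: r) = support s ps :|: support t r.
Proof. by elim: ps s => [|p ps IH] s /=; rewrite ?setU0 // IH setUA. Qed.

Lemma support_map_cons a s ps :
  support (a :: s) (map (cons a) ps) = a |: support s ps.
Proof.
elim: ps s => [|t ps IH] s /=; first by rewrite !setU0 vset_cons.
by rewrite IH vset_cons setUACA setUid.
Qed.

Lemma support_verts C S s ss : is_complex C -> mc_path C S s ss ->
  support s ss \subset verts C.
Proof.
move=> cC; elim: ss s => [|t ss IH] s /= [os _ path_ss].
all: rewrite subUset ?sub0set ?andbT; have Cs := ordered_facet_mem os.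
2: apply/andP; split; last by apply: IH; case: path_ss.
all: by apply/subsetP=> x sx; rewrite inE (cC.2 _ _ Cs) // sub1set.
Qed.

Lemma support_link_notin C S a s ss : is_complex C -> [set a] \in C ->
  mc_path (link C a) S s ss -> a \notin support s ss.
Proof.
move=> cC Ca path_ss; apply/negP=> ass.
have := subsetP (support_verts (link_complex cC Ca) path_ss) a ass.
by rewrite verts_link // /edge /= eqxx.
Qed.

Lemma mc_path_suffix C S s ss x : mc_path C S s ss -> x \in support s ss ->
  exists t r, [/\ mc_path C S t r, x \in t, last t r = last s ss
    & support t r \subset support s ss].
Proof.
elim: ss s => [|u ss IH] s path_ss /setUP[].
- by rewrite inE => sx; exists s, [::].
- by rewrite inE.
- by rewrite inE => sx; exists s, (u :: ss).
case: path_ss => _ _ [_ path_ss] /(IH _ path_ss)[t [r [path_r tx el sub]]].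
by exists t, r; split=> //=; apply: subset_trans sub (subsetUr _ _).
Qed.

(** * Distances to the target along runs *)

Lemma constant_head_vdist C S a s ps x :
  mc_path C S (a :: s) (map (cons a) ps) ->
  x \in support (a :: s) (map (cons a) ps) ->
  (vdistS C [set a] S <= vdistS C [set x] S)%O.
Proof.
elim: ps s => [|t ps IH] s path_ps /setUP[];
  have [_ /andP[/eqP Da _]] := mc_path_head path_ps.
(* Admissibility puts a nearest vertex of each facet first, and here that vertex is always [a]. *)
- by move=> xs; rewrite Da vdistS_le_mem.
- by rewrite inE.
- by move=> xs; rewrite Da vdistS_le_mem.
by case: path_ps => _ _ [_ path_ps] /(IH _ path_ps).
Qed.

Lemma face_near_vertex C S F b m x : is_complex C ->
  F \in C -> b \in F -> vdistS C [set b] S = Some m -> x \in F ->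
  (vdistS C [set x] S <= (Some m : enat))%O \/ edge C x b.
Proof.
move=> cC CF Fb Db Fx; have [-> | xb] := eqVneq x b; first by left; rewrite Db.
by right; apply: (face_edge cC CF).
Qed.

(** In the run of [b], every other vertex is adjacent to [b]. The next head is at distance [m - 1],
    so by induction a vertex of a later run is within [m - 1] of [S] or adjacent to that head, hence
    within [m]. *)
Lemma support_near_head C S d b t r m x : is_complex C -> pure C d -> 1 < d ->
  mc_path C S (b :: t) r -> vdistS C [set b] S = Some m ->
  x \in support (b :: t) r ->
  (vdistS C [set x] S <= (Some m : enat))%O \/ edge C x b.
Proof.
move=> cC pC d1.
have rC : rank C != 1 by rewrite (rank_pure cC.1 pC) neq_ltn d1 orbT.
elim: r b t m => [|u r IH] b t m path_r Db xr;
  have [obt adm] := mc_path_head path_r.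
  rewrite /= setU0 in xr.
  apply: (face_near_vertex cC (ordered_facet_mem obt) _ Db xr).
  by rewrite inE mem_head.
move: xr => /setUP[xr|].
  apply: (face_near_vertex cC (ordered_facet_mem obt) _ Db xr).
  by rewrite inE mem_head.
case: path_r => _ _ []; case: u => [|c u] st path_r xr.
  have [/(ordered_facet_size pC) /= ou _] := mc_path_head path_r.
  by rewrite -ou in d1.
have [ocu _] := mc_path_head path_r.
case: (mc_step_head cC pC d1 obt adm ocu st) => [ecb | [m' Dbm Dcm]].
  by rewrite ecb in path_r xr; apply: IH path_r Db xr.
move: Db; rewrite Dbm => -[<-]; left.
have [Dx | exc] := IH _ _ _ path_r Dcm xr; last first.
  by apply: vdistS_edge exc _; rewrite ?Dcm.
by apply: le_trans Dx _; rewrite leEenat /=.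
Qed.

Lemma next_target_far C S a m : rank C != 1 -> vdistS C [set a] S = Some m.+1 ->
  next_target C a S
  = [set u in verts (link C a) | vdistS C [set u] S == Some m].
Proof.
move=> rC Da; rewrite /next_target; case: ifP => [|_]; last by rewrite Da.
by rewrite -(vdistS_eq0 _ _ rC) Da.
Qed.

(** The target in the link consists of vertices at distance [m], while the run of [a] only meets
    vertices at distance at least [m + 1]. *)
Lemma next_target_avoided C S d a s ps m : is_complex C -> pure C d -> 1 < d ->
  mc_path C S (a :: s) (map (cons a) ps) -> vdistS C [set a] S = Some m.+1 ->
  [disjoint support s ps & next_target C a S].
Proof.
move=> cC pC d1 path_ps Da.
have rC : rank C != 1 by rewrite (rank_pure cC.1 pC) neq_ltn d1 orbT.
rewrite (next_target_far rC Da) disjoint_subset.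
apply/subsetP=> x xps; rewrite !inE negb_and; apply/orP; right.
have := constant_head_vdist path_ps (x := x).
rewrite support_map_cons Da => /(_ (setU1r _ xps)).
by apply: contraTneq => ->; rewrite leEenat /= ltnn.
Qed.

(** Induction on [d]. The head [a] survives the last step because only the last vertex is dropped.
    For any other [x], the part of the run from a facet containing [x] onwards turns out to be a
    single run in the link of [a], with [b] in its target, and the induction hypothesis applies
    there. *)
Lemma persistence d C S a s ps G b x m :
  1 < d -> is_complex C -> pure C d -> banner 2 C ->
  mc_path C S (a :: s) (map (cons a) ps) ->
  mc_path (link C a) (next_target C a S) s ps ->
  vdistS C [set a] S = Some m.+1 -> vdistS C [set b] S = Some m ->
  G \in C -> b \in G -> drops_last (a :: last s ps) G ->
  x \in support (a :: s) (map (cons a) ps) -> edge C x b ->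
  x \in vset (a :: last s ps) :&: G.
Proof.
elim: d C S a s ps G b x m => // d IH C S a s ps G b x m d1 cC pC bC
  path_ps path_l Da Db CG Gb dl xps exb.
have rC : rank C != 1 by rewrite (rank_pure cC.1 pC) neq_ltn d1 orbT.
have ola : ordered_facet C (a :: last s ps).
  have := mc_path_last path_ps.
  by rewrite (last_map (cons a)).
have l0 : last s ps != [::].
  by have := ordered_facet_size pC ola; case: (last s ps) => //= -[] ed; lia.
have [Ga dlG] := drops_last_cons l0 (proj1 (andP ola)) dl.
have ab : a != b.
  by apply: contra_eq_neq Da => ->; rewrite Db; apply/eqP=> -[/n_Sn].
have eab : edge C a b by apply: face_edge CG _ _ _.
have Ca : [set a] \in C by apply: (cC.2 G); rewrite // sub1set.
rewrite support_map_cons in xps; rewrite inE vset_cons.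
have [-> | xa] := eqVneq x a; first by rewrite setU11.
have {}xps : x \in support s ps.
  by move: xps; rewrite in_setU1 (negPf xa).
have avoid := next_target_avoided cC pC d1 path_ps Da.
set L := link C a in path_l *; set T := next_target C a S in path_l avoid.
have cL : is_complex L by apply: link_complex.
have pL : pure L d by apply: link_pure cC pC.
have bL : banner 2 L by apply: link_banner => //; apply: banner_leq bC.
have eax : edge C a x.
  by rewrite -verts_link //; apply: (subsetP (support_verts cL path_l)).
have Lxb : edge L x b.
  case/andP: (exb) => xb _; rewrite /edge /= xb mem_link // !inE negb_or.
  rewrite ![a == _]eq_sym xa eq_sym ab /= setUA.
  exact: flag_triangle.
(* The edge between [x] and [b] lies in a facet of [L], so the link is still of rank at least 2. *)
have d2 : 1 < d.
  have /andP[xb /face_sub_facet[H fH]] := Lxb.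
  by move/subset_leq_card; rewrite (pL _ fH) cards2 xb.
have rL : rank L != 1 by rewrite (rank_pure cL.1 pL) neq_ltn d2 orbT.
have Tb : b \in T.
  by rewrite /T (next_target_far rC Da) inE verts_link // eab Db /=.
have notT y : y \in support s ps -> vdistS L [set y] T != Some 0.
  by move=> yps; rewrite vdistS_eq0 // (disjointFr avoid yps).
have Db' : vdistS L [set b] T = Some 0 by apply/eqP; rewrite vdistS_eq0.
have [t [r [path_r tx el sub]]] := mc_path_suffix path_l xps.
have [ot adt] := mc_path_head path_r.
case: t => [|c t] in path_r tx el sub ot adt *; first by [].
(* At most 1, because [c] is a nearest vertex of a facet containing [x], which is adjacent to [b] in
   [T]; not 0, because the run avoids [T]. *)
have Dc : vdistS L [set c] T = Some 1.
  have /andP[/eqP Dc _] := adt.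
  have : (vdistS L [set c] T <= (Some 1 : enat))%O.
    rewrite Dc; apply: le_trans (vdistS_le_mem L T (_ : x \in _)) _.
      by rewrite inE.
    by apply: vdistS_edge Lxb _; rewrite ?Db'.
  have := notT c (subsetP sub c _).
  have cs : c \in support (c :: t) r.
    by case: (r) => [|? ?] /=; rewrite !inE eqxx.
  by move/(_ cs); case: (vdistS L [set c] T) => [[|[|?]]|].
(* A change of head would lead to a head at distance 0, that is, in [T]. *)
have [ps' path_l' [er | [c' [t' [r' [m' [er _ _ Dc' Dc'']]]]]]] :=
    mc_path_split cL pL d2 path_r; last first.
  have c'r : c' \in support (c :: t) r.
    rewrite er support_cat inE; apply/orP; right.
    by case: (r') => [|? ?] /=; rewrite !inE eqxx.
  have /eqP[] := notT c' (subsetP sub c' c'r).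
  by move: Dc'; rewrite Dc Dc'' => -[<-].
rewrite er in path_r sub el.
have ell : c :: last t ps' = last s ps by rewrite -el (last_map (cons c)).
have xr : x \in support (c :: t) (map (cons c) ps').
  by rewrite support_map_cons; move: tx; rewrite in_cons in_setU1;
    case: (x == c) => //= tx; case: (ps') => [|? ?] /=; rewrite !inE tx.
have := IH L T c t ps' (G :\ a) b x 0 d2 cL pL bL path_r path_l' Dc Db'
  (link_setD1 cC CG Ga) _ _ xr Lxb.
rewrite ell !inE Gb eq_sym ab => /(_ isT dlG) /andP[-> /andP[_ ->]].
by rewrite orbT.
Qed.

(** * Bounds on the length *)

Lemma rank1_bound C S s ss : is_complex C -> pure C 1 -> mc_path C S s ss ->
  size ss < #|support s ss|.
Proof.
move=> cC pC; have rC : rank C == 1 by rewrite (rank_pure cC.1 pC).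
have one t r : mc_path C S t r -> exists v, t = [:: v].
  case/mc_path_head=> /(ordered_facet_size pC).
  by case: t => [|v []] // _ _; exists v.
case: ss => [|t ss] path_s.
  by have [v ->] := one _ _ path_s; rewrite /= vset_cons card_gt0;
    apply/set0Pn; exists v; rewrite !inE eqxx.
have [v es] := one _ _ path_s; rewrite es in path_s *.
case: path_s => _ _ [[_ lt_ts] path_t].
have [w et] := one _ _ path_t; rewrite et in path_t lt_ts *.
move: lt_ts; rewrite /= ltxi_cons implybF -ltNge.
case/andP=> _ lt_wv; case: ss path_t => [|u ss] path_t.
  have vw : v != w by apply: contraTneq lt_wv => ->; rewrite ltxx.
  apply: leq_trans (subset_leq_card (_ : [set v; w] \subset _)).
    by rewrite cards2 vw.
  by apply/subsetP=> x; rewrite /= !inE => /orP[] ->; rewrite ?orbT.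
case: path_t => _ _ [[_ lt_ut] path_u].
have [z eu] := one _ _ path_u; rewrite eu in path_u lt_ut.
move: lt_ut; rewrite /= ltxi_cons implybF -ltNge => /andP[_ lt_zw].
(* In rank 1 distances are 0 or 1, or all infinite for empty [S]; a strict drop goes from 1 to 0,
   and two in a row are impossible. *)
have two y y' : (vdistS C [set y] S < vdistS C [set y'] S)%O ->
    vdistS C [set y] S = Some 0 /\ vdistS C [set y'] S = Some 1.
  rewrite /vdistS rC -!cards_eq0 !cards1 /=; case: (#|S| == 0) => //=.
  by do 2!case: ifP.
by have [_ Dw1] := two _ _ lt_zw; have [] := two _ _ lt_wv; rewrite Dw1.
Qed.

(** The summand [d] makes the bound glue: the supports of the first run and of the rest share at
    most [d - 1] vertices, and the sum of their bounds minus this overlap also pays for the joining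
    step. Induction on [d] treats the run, induction on the length the rest. *)
Lemma flag_bound d C S s ss : 0 < d -> is_complex C -> pure C d -> banner 2 C ->
  mc_path C S s ss -> size ss + d <= #|support s ss|.
Proof.
elim: d C S s ss => // d IH C S s ss _.
have [n] := ubnP (size ss).
elim: n C S s ss => // n IHn C S s ss le_n cC pC bC path_s.
have [d0 | d1] := leqP d 0.
  move: d0 pC; rewrite leqn0 => /eqP-> pC.
  by rewrite addn1; apply: rank1_bound path_s.
have rC : rank C != 1 by rewrite (rank_pure cC.1 pC); lia.
have [os _] := mc_path_head path_s.
case: s => [|a s] in path_s os *; first by have := ordered_facet_size pC os.
have Ca : [set a] \in C.
  by apply: (cC.2 _ _ (ordered_facet_mem os)); rewrite sub1set inE mem_head.
have [ps path_l ess] := mc_path_split cC pC (d1 : 1 < d.+1) path_s.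
(* The link has rank [d]; the vertex [a], absent from it, accounts for the extra 1. *)
have boundA : size ps + d.+1 <= #|support (a :: s) (map (cons a) ps)|.
  rewrite support_map_cons cardsU1 (support_link_notin cC Ca path_l) addnS ltnS.
  apply: (IH (link C a)) path_l => //; first exact: link_complex.
    exact: link_pure pC.
  by apply: link_banner => //; apply: banner_leq bC.
case: ess => [ess | [b [t [r [m [ess dl path_r Da Db]]]]]].
  by rewrite ess size_map.
have path_ps : mc_path C S (a :: s) (map (cons a) ps).
  by apply: (mc_path_catl (r := (b :: t) :: r)); rewrite -ess.
have [obt _] := mc_path_head path_r.
have boundR : size r + d.+1 <= #|support (b :: t) r|.
  apply: IHn path_r => //; move: le_n.
  by rewrite ess size_cat size_map /=; lia.
have ola : ordered_facet C (a :: last s ps).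
  by have := mc_path_last path_ps; rewrite (last_map (cons a)).
have overlap : support (a :: s) (map (cons a) ps) :&: support (b :: t) r
    \subset vset (a :: last s ps) :&: vset (b :: t).
  apply/subsetP=> x /setIP[xps xr].
  have [Dx | exb] := support_near_head cC pC (d1 : 1 < d.+1) path_r Db xr.
    have := le_trans (constant_head_vdist path_ps xps) Dx.
    by rewrite Da leEenat /= ltnn.
  apply: (persistence (d1 : 1 < d.+1) cC pC bC path_ps path_l Da Db) => //.
    exact: ordered_facet_mem.
  by rewrite inE mem_head.
(* The last facet of the run has [d + 1] vertices and loses exactly one. *)
have cardI : #|vset (a :: last s ps) :&: vset (b :: t)| <= d.
  have := cardsID (vset (b :: t)) (vset (a :: last s ps)).
  have [s' [l [_ ->]]] := dl.
  by rewrite cards1 (pC _ (proj2 (andP ola))); lia.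
have := cardsUI (support (a :: s) (map (cons a) ps)) (support (b :: t) r).
have := leq_trans (subset_leq_card overlap) cardI.
rewrite ess support_cat size_cat size_map /=; lia.
Qed.

(* A vertex at distance delta from S lies only on facets whose distance to S
   is delta or delta - 1; counting it twice pays for both runs, except when
   delta exceeds the distance of the first facet, where one run suffices. *)
Lemma link_bound_lift c d C S a s ss : 0 < c ->
  1 < d -> is_complex C -> pure C d ->
  (forall v T t r, [set v] \in C -> mc_path (link C v) T t r ->
     size r <= c * #|support t r|) ->
  mc_path C S (a :: s) ss ->
  size ss < c * (#|support (a :: s) ss| + #|[set x in support (a :: s) ss |
    (vdistS C [set x] S <= vdistS C [set a] S)%O]|).
Proof.
move=> c0 d1 cC pC boundL.
have rC : rank C != 1 by rewrite (rank_pure cC.1 pC) neq_ltn d1 orbT.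
have [n] := ubnP (size ss); elim: n a s ss => // n IHn a s ss le_n path_s.
have [os _] := mc_path_head path_s.
have Ca : [set a] \in C.
  by apply: (cC.2 _ _ (ordered_facet_mem os)); rewrite sub1set inE mem_head.
have [ps path_l ess] := mc_path_split cC pC d1 path_s.
(* The vertex [a] lies outside its link and makes the bound strict, which pays for the step into the
   next run. *)
have boundA : size ps < c * #|support (a :: s) (map (cons a) ps)|.
  rewrite support_map_cons cardsU1 (support_link_notin cC Ca path_l).
  by have := boundL _ _ _ _ Ca path_l; lia.
case: ess => [ess | [b [t [r [m [ess dl path_r Da Db]]]]]].
  by rewrite ess size_map; nia.
have path_ps : mc_path C S (a :: s) (map (cons a) ps).
  by apply: (mc_path_catl (r := (b :: t) :: r)); rewrite -ess.
have boundR : size r < c * (#|support (b :: t) r| +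
    #|[set x in support (b :: t) r |
       (vdistS C [set x] S <= (Some m : enat))%O]|).
  rewrite -Db; apply: IHn path_r; move: le_n.
  by rewrite ess size_cat size_map /=; lia.
have nearA x : x \in support (a :: s) (map (cons a) ps) ->
    ~~ (vdistS C [set x] S <= (Some m : enat))%O.
  move=> xps; apply/negP=> Dx.
  have := le_trans (constant_head_vdist path_ps xps) Dx.
  by rewrite Da leEenat /= ltnn.
have nearR x : x \in support (b :: t) r ->
    (vdistS C [set x] S <= (Some m.+1 : enat))%O.
  case/(support_near_head cC pC d1 path_r Db) => [Dx | exb].
    by apply: le_trans Dx _; rewrite leEenat /=.
  by apply: vdistS_edge exb _; rewrite ?Db.
rewrite ess size_cat size_map support_cat Da /=.
move: boundA boundR nearA nearR.
set A := support (a :: s) _; set U := support (b :: t) r.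
set N := [set x in U | _]; set M := [set x in A :|: U | _].
move=> boundA boundR nearA nearR.
(* [A] lies beyond distance [m] and [N] within it, so they are disjoint. *)
have leAN : #|A| + #|N| <= #|A :|: U|.
  rewrite -cardsUI [A :&: N](_ : _ = set0) ?cards0 ?addn0.
    by apply: subset_leq_card; rewrite setUS //; apply/subsetP=> x /setIdP[].
  apply/setP=> x; rewrite !inE; apply/negbTE/negP=> /and3P[Ax _ Dx].
  by have := nearA x Ax; rewrite Dx.
have leUM : #|U| <= #|M|.
  by apply/subset_leq_card/subsetP=> x Ux; rewrite inE in_setU Ux orbT nearR.
have := leq_mul (leqnn c) (leq_add leAN leUM); lia.
Qed.

(** Induction on [k] from the flag case: links lower the banner parameter by one, and each vertex
    being counted at most twice doubles the constant. *)
Lemma mc_path_bound k d C S s ss : 0 < d -> is_complex C -> pure C d ->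
  banner k.+2 C -> mc_path C S s ss -> size ss <= #|support s ss| * 2 ^ k.
Proof.
elim: k d C S s ss => [|k IH] d C S s ss d0 cC pC bC path_s.
  by have := flag_bound d0 cC pC bC path_s; rewrite expn0 muln1; lia.
(* Rank 1 is settled directly, since passing to links requires rank at least 2. *)
case: d d0 pC => [|[|d]] // _ pC.
  have := rank1_bound cC pC path_s.
  have : 0 < 2 ^ k.+1 by rewrite expn_gt0.
  by nia.
have [os _] := mc_path_head path_s.
case: s => [|a s] in path_s os *; first by have := ordered_facet_size pC os.
have boundL v T t r : [set v] \in C -> mc_path (link C v) T t r ->
    size r <= 2 ^ k * #|support t r|.
  move=> Cv; rewrite mulnC; apply: (IH d.+1) => //.
  - exact: link_complex.
  - exact: link_pure pC.
  - exact: link_banner.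
have k0 : 0 < 2 ^ k by rewrite expn_gt0.
have := link_bound_lift k0 (isT : 1 < d.+2) cC pC boundL path_s.
set M := [set x in _ | _] => lt_size.
have /(leq_mul (leqnn (2 ^ k))) leM : #|M| <= #|support (a :: s) ss|.
  by apply: subset_leq_card; apply/subsetP=> x /setIdP[].
rewrite expnS; lia.
Qed.

End MonotoneConservative.

Theorem theorem3p9 (V : finType) (d k n : nat) (C : {set {set V}})
    (S : {set V}) (F0 : seq V) (Fs : seq (seq V)) :
  2 <= d -> 2 <= k ->
  is_complex C -> pure C d -> normal_complex C -> banner k C ->
  #|verts C| = n ->
  S \subset verts C -> S != set0 ->
  monotone_conservative_path C S F0 Fs ->
  size Fs <= n * 2 ^ (k - 2).
Proof.
move=> d2 k2 cC pC _ bC <- _ _ /mc_pathP path_s.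
rewrite -(subnK k2) addn2 in bC.
apply: leq_trans (mc_path_bound (ltnW d2) cC pC bC path_s) _.
by rewrite leq_mul2r (subset_leq_card (support_verts cC path_s)) orbT.
Qed.
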